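(* Let $B$ be a graph and $\Psi=\{[\psi^1_{/B}],\dots,[\psi^m_{/B}]\}$ a finite set of isomorphism classes of $B$-graphs such that $\Psi^+_{<s}$ is finite for all $s\in\mathbb N$ and each $\psi^i$ is pruned. Then for each $[\psi_{/B}]\in\Psi^+$ there is a rational number $\mu[\psi_{/B}]$ such that for every $r\in\mathbb N$ the function $$I_r(\Psi,G_{/B})=\sum_{[\psi_{/B}]\in\Psi^+_{<r}}\#\bigl([\psi_{/B}]\cap G\bigr)\,\mu[\psi_{/B}]$$ (defined on $B$-graphs $G_{/B}$) satisfies: (1) $I_r(\Psi,G_{/B})=\mathbf 1_{\mathrm{Meets}(\Psi)}(G_{/B})$ whenever $\mathrm{ord}_\Psi(G_{/B})<r$; and (2) there are a constant $C\in\mathbb R$ and $s\in\mathbb N$ such that whenever $\mathrm{ord}_\Psi(G_{/B})\ge r$, $$\bigl|I_r(\Psi,G_{/B})\bigr|\le C\sum_{[\psi_{/B}]\in\Psi^+_{<r+s}\setminus\Psi^+_{<r}}\#\bigl([\psi_{/B}]\cap G\bigr).$$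
   Context: All graphs are finite. A graph $G$ consists of finite sets $V_G,E^{\mathrm{dir}}_G$, maps $h_G,t_G\colon E^{\mathrm{dir}}_G\to V_G$ and an involution $\iota_G$ with $t_G\iota_G=h_G$; its edges $E_G$ are the $\iota_G$-orbits; the degree of $v$ is $\#\{e:t_Ge=v\}$; $G$ is pruned if every vertex has degree $\ge2$; $\mathrm{ord}(G)=\#E_G-\#V_G$. A $B$-graph is a graph with a morphism (compatible with heads, tails, involutions) to $B$; $[\psi_{/B}]$ denotes its isomorphism class as a $B$-graph, and $\#([\psi_{/B}]\cap G)$ is the number of $B$-subgraphs of $G_{/B}$ isomorphic to $\psi_{/B}$. $\Psi^+$ is the set of classes $[\psi_{/B}]$ such that $\psi_{/B}$ is a union of one or more $B$-subgraphs each isomorphic to some $\psi^i_{/B}$; $\Psi^+_{<r}$ consists of those with $\mathrm{ord}(\psi)<r$. $\Psi^+\cap G_{/B}$ is the union of all $B$-subgraphs of $G_{/B}$ lying in a class of $\Psi$, and $\mathrm{ord}_\Psi(G_{/B})=\mathrm{ord}(\Psi^+\cap G_{/B})$. $\mathrm{Meets}(\Psi)$ is the class of $B$-graphs having a nonempty $B$-subgraph lying in some class of $\Psi$. *)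

(* Defs.v *)
From HB Require Import structures.
From mathcomp Require Import all_boot all_order all_algebra.
From mathcomp Require Import all_classical all_reals numfun.
Set Implicit Arguments.
Unset Strict Implicit.
Unset Printing Implicit Defensive.
Import Order.TTheory GRing.Theory Num.Theory.
Local Open Scope classical_set_scope.
Local Open Scope ring_scope.

(* The carriers are stored as types with a finType class rather than as       *)
(* finTypes: a record over the type finType would live in too large a         *)
(* universe for sets of graphs to be used with finite_set and \sum_(c \in A). *)
Record graph := Graph {
  vtx : Type;
  vtx_class : Finite vtx;
  dedge : Type;
  dedge_class : Finite dedge;
  ghead : dedge -> vtx;
  gtail : dedge -> vtx;
  ginv : dedge -> dedge;
  ginvK : involutive ginv;
  gtail_inv : forall e, gtail (ginv e) = ghead e }.

HB.instance Definition _ (G : graph) :=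
  Finite.copy (vtx G) (Finite.Pack (vtx_class G)).
HB.instance Definition _ (G : graph) :=
  Finite.copy (dedge G) (Finite.Pack (dedge_class G)).

(* The orbits of the involution; its fixed points (half-loops) are allowed    *)
(* and each of them is one edge.                                              *)
Definition edges (G : graph) : {set {set dedge G}} :=
  [set [set e; ginv e]%SET | e in [set: dedge G]%SET]%SET.

Definition ord (G : graph) : int := #|edges G|%:Z - #|[set: vtx G]%SET|%:Z.

Definition degree (G : graph) (v : vtx G) : nat :=
  #|[set e : dedge G | gtail e == v]%SET|.

Definition pruned (G : graph) : Prop := forall v : vtx G, (2 <= degree v)%N.

Definition is_morphism (G H : graph)
    (fV : vtx G -> vtx H) (fE : dedge G -> dedge H) : Prop :=
  [/\ forall e, ghead (fE e) = fV (ghead e),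
      forall e, gtail (fE e) = fV (gtail e)
    & forall e, ginv (fE e) = fE (ginv e)].

Record bgraph (B : graph) := BGraph {
  under :> graph;
  mapV : vtx under -> vtx B;
  mapE : dedge under -> dedge B;
  map_morph : is_morphism mapV mapE }.

Definition bisom (B : graph) (G H : bgraph B) : Prop :=
  exists (fV : vtx G -> vtx H) (fE : dedge G -> dedge H),
    [/\ bijective fV, bijective fE, is_morphism fV fE,
        (forall v, mapV (fV v) = mapV v) & (forall e, mapE (fE e) = mapE e)].

Definition isoclass (B : graph) (psi : bgraph B) : set (bgraph B) :=
  [set phi | bisom psi phi].

Section Subgraph.
Variable G : graph.

Definition subgraph_axiom (S : {set vtx G} * {set dedge G}) : bool :=
  [forall e in S.2, [&& ghead e \in S.1, gtail e \in S.1 & ginv e \in S.2]].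

Record subgraph := Subgraph {
  subgraph_val : {set vtx G} * {set dedge G};
  subgraphP : subgraph_axiom subgraph_val }.

HB.instance Definition _ := [isSub for subgraph_val].
HB.instance Definition _ := [Finite of subgraph by <:].

Definition svtx (S : subgraph) : {set vtx G} := (subgraph_val S).1.
Definition sdedge (S : subgraph) : {set dedge G} := (subgraph_val S).2.

Lemma subgraph_head S e : e \in sdedge S -> ghead e \in svtx S.
Proof. by move: (subgraphP S) => /'forall_implyP /[apply] /and3P[]. Qed.

Lemma subgraph_tail S e : e \in sdedge S -> gtail e \in svtx S.
Proof. by move: (subgraphP S) => /'forall_implyP /[apply] /and3P[]. Qed.

Lemma subgraph_inv S e : e \in sdedge S -> ginv e \in sdedge S.
Proof. by move: (subgraphP S) => /'forall_implyP /[apply] /and3P[]. Qed.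

Section ToGraph.
Variable S : subgraph.
Let SV : Type := {v : vtx G | v \in svtx S}.
Let SE : Type := {e : dedge G | e \in sdedge S}.

Definition sub_head (e : SE) : SV := Sub (ghead (val e)) (subgraph_head (valP e)).
Definition sub_tail (e : SE) : SV := Sub (gtail (val e)) (subgraph_tail (valP e)).
Definition sub_inv (e : SE) : SE := Sub (ginv (val e)) (subgraph_inv (valP e)).

Lemma sub_invK : involutive sub_inv.
Proof. by move=> e; apply: val_inj; rewrite /= ginvK. Qed.

Lemma sub_tail_inv e : sub_tail (sub_inv e) = sub_head e.
Proof. by apply: val_inj; rewrite /= gtail_inv. Qed.

Definition sub_graph : graph :=
  @Graph SV (Finite.class (SV : finType)) SE (Finite.class (SE : finType))
    sub_head sub_tail sub_inv sub_invK sub_tail_inv.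

End ToGraph.

Lemma subgraph_full_subproof : subgraph_axiom ([set: vtx G], [set: dedge G])%SET.
Proof. by apply/'forall_implyP => e _; rewrite !inE. Qed.

Definition subgraph_full : subgraph := Subgraph subgraph_full_subproof.

Lemma subgraph_union_subproof (P : {set subgraph}) :
  subgraph_axiom (\bigcup_(S in P) svtx S, \bigcup_(S in P) sdedge S)%SET.
Proof.
apply/'forall_implyP => e /bigcupP[S SP eS]; apply/and3P; split; apply/bigcupP;
  exists S => //.
- exact: subgraph_head.
- exact: subgraph_tail.
- exact: subgraph_inv.
Qed.

Definition subgraph_union (P : {set subgraph}) : subgraph :=
  Subgraph (subgraph_union_subproof P).

End Subgraph.

Section BSubgraph.
Variables (B : graph) (G : bgraph B) (S : subgraph G).

Lemma sub_morph : @is_morphism (sub_graph S) B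
  (fun v => mapV (val v)) (fun e => mapE (val e)).
Proof. by case: (map_morph G) => hh ht hi; split=> e /=. Qed.

Definition sub_bgraph : bgraph B := BGraph sub_morph.

End BSubgraph.

Definition count_in (B : graph) (c : set (bgraph B)) (G : bgraph B) : nat :=
  #|[set S : subgraph G | `[< c (sub_bgraph S) >]]%SET|.

Section Psi.
Variables (B : graph) (Psi : set (set (bgraph B))).

Definition lies_in (G : bgraph B) : Prop := exists2 c, Psi c & c G.

Definition is_Psi_union (psi : bgraph B) : Prop :=
  exists P : {set subgraph psi},
    [/\ P != finset.set0, forall S, S \in P -> lies_in (sub_bgraph S)
      & subgraph_union P = subgraph_full psi].

Definition Psi_plus : set (set (bgraph B)) :=
  [set isoclass psi | psi in [set psi | is_Psi_union psi]].

Definition Psi_plus_lt (r : nat) : set (set (bgraph B)) :=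
  [set isoclass psi | psi in [set psi | is_Psi_union psi /\ ord psi < r%:Z]].

Definition Psi_plus_cap (G : bgraph B) : subgraph G :=
  subgraph_union [set S : subgraph G | `[< lies_in (sub_bgraph S) >]]%SET.

Definition ord_Psi (G : bgraph B) : int := ord (sub_bgraph (Psi_plus_cap G)).

Definition Meets : set (bgraph B) :=
  [set G : bgraph B | exists2 S : subgraph G,
     svtx S != finset.set0 & lies_in (sub_bgraph S)].

(* \sum_(c \in A) is the sum over the finite support; it is the sum over A    *)
(* whenever A is finite. Only the values of mu on Psi_plus are used.          *)
Definition I_ (mu : set (bgraph B) -> rat) (r : nat) (G : bgraph B) : rat :=
  \sum_(c \in Psi_plus_lt r) (count_in c G)%:R * mu c.

End Psi.

(* Main.v *)
Require Import Defs.
From mathcomp Require Import all_boot all_order all_algebra.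
From mathcomp Require Import all_classical all_reals numfun.
From mathcomp Require Import zify.
Set Implicit Arguments.
Unset Strict Implicit.
Unset Printing Implicit Defensive.
Import Order.TTheory GRing.Theory Num.Theory.
Local Open Scope classical_set_scope.
Local Open Scope ring_scope.

(* Call a subgraph of G lying in a class of Psi a piece. By inclusion-exclusion
   over the nonempty pieces of G, the indicator of Meets(Psi) is the sum over
   the nonempty sets P of such pieces of (-1)^(#P + 1). Grouping the P by their
   union S writes it as a sum of mu(S) over all subgraphs S of G, where mu(S)
   depends only on the isomorphism class of S and vanishes off Psi^+.
   Below a pruned graph ord is monotone, so if ord_Psi(G) < r no union of pieces
   is cut off. If ord_Psi(G) >= r, adding pieces one at a time extends every
   union of order < r to one of order in [r, r + N), with N a bound on the number
   of directed edges of the psi^i; as only finitely many classes occur there,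
   each of them contains boundedly many subgraphs, and mu is bounded. *)

(** * Isomorphism of [B]-graphs as an equivalence relation *)

Lemma bisom_refl (B : graph) (G : bgraph B) : bisom G G.
Proof. by exists id, id; split=> //; exists id. Qed.

Lemma bisom_sym (B : graph) (G H : bgraph B) : bisom G H -> bisom H G.
Proof.
move=> [fV [fE [[gV fVK gVK] [gE fEK gEK] [hh ht hi] mV mE]]].
exists gV, gE; split.
- by exists fV.
- by exists fE.
- split=> e; rewrite -{2}[e]gEK.
  + by rewrite hh fVK.
  + by rewrite ht fVK.
  + by rewrite hi fEK.
- by move=> v; rewrite -mV gVK.
- by move=> e; rewrite -mE gEK.
Qed.

Lemma bisom_trans (B : graph) (G H K : bgraph B) :
  bisom G H -> bisom H K -> bisom G K.
Proof.
move=> [fV [fE [bV bE [hh ht hi] mV mE]]].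
move=> [gV [gE [bV' bE' [hh' ht' hi'] mV' mE']]].
exists (gV \o fV), (gE \o fE); split.
- exact: bij_comp.
- exact: bij_comp.
- by split=> e /=; rewrite (hh', ht', hi') (hh, ht, hi).
- by move=> v /=; rewrite mV'.
- by move=> e /=; rewrite mE'.
Qed.

Lemma isoclass_eqP (B : graph) (G H : bgraph B) :
  isoclass G = isoclass H <-> bisom G H.
Proof.
split=> [GH|GH].
  by have : isoclass H H := bisom_refl H; rewrite -GH.
apply/seteqP; split=> K; apply: bisom_trans => //; exact: bisom_sym.
Qed.

(** * Inclusion, unions, pruning and order of subgraphs of a fixed graph *)

Section SubgraphOrder.
Variable G : graph.
Implicit Types S T : subgraph G.
Implicit Types P Q : {set subgraph G}.

Definition subgraph_le S T :=
  (svtx S \subset svtx T) && (sdedge S \subset sdedge T).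

Lemma subgraph_eq S T : svtx S = svtx T -> sdedge S = sdedge T -> S = T.
Proof.
case: S T => [[V E] p] [[V' E'] p']; rewrite /svtx /sdedge /= => eV eE.
by apply: val_inj; rewrite /= eV eE.
Qed.

Lemma subgraph_le_trans S T U :
  subgraph_le S T -> subgraph_le T U -> subgraph_le S U.
Proof.
move=> /andP[a b] /andP[c d]; apply/andP; split.
- exact: fintype.subset_trans a c.
- exact: fintype.subset_trans b d.
Qed.

Lemma subgraph_union_ub P S : S \in P -> subgraph_le S (subgraph_union P).
Proof. by move=> SP; apply/andP; split; apply: finset.bigcup_sup SP. Qed.

Lemma subgraph_union_mono P Q :
  P \subset Q -> subgraph_le (subgraph_union P) (subgraph_union Q).
Proof.
move=> PQ; apply/andP; split; apply/finset.bigcupsP => S SP;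
  by apply: finset.bigcup_sup; apply: (fintype.subsetP PQ).
Qed.

(** Edges, pruning and order of a subgraph are phrased with sets of the ambient graph, so that
    different subgraphs can be compared without passing to their sigma-type carriers. [ord_emb] and
    [pruned_emb] link these notions to the intrinsic ones. *)
Definition subgraph_edges S : {set {set dedge G}} :=
  [set [set e; ginv e]%SET | e in sdedge S]%SET.

Definition pruned_sub S : Prop :=
  forall v, v \in svtx S ->
  (2 <= #|[set e in sdedge S | gtail e == v]%SET|)%N.

Lemma pruned_sub_union P :
  (forall S, S \in P -> pruned_sub S) -> pruned_sub (subgraph_union P).
Proof.
move=> prP v /finset.bigcupP[S SP vS].
apply: leq_trans (prP _ SP _ vS) _; apply: subset_leq_card.
apply/fintype.subsetP => e; rewrite !inE => /andP[eS ->]; rewrite andbT.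
by apply/finset.bigcupP; exists S.
Qed.

Definition ord_sub S : int := #|subgraph_edges S|%:Z - #|svtx S|%:Z.

(* Each vertex of T outside S is the tail of at least two directed edges of
   T, none of which lies in S, and an edge consists of at most two of them. *)
Lemma ord_sub_mono S T : subgraph_le S T -> pruned_sub T ->
  ord_sub S <= ord_sub T.
Proof.
move=> /andP[sV sE] prT.
pose D := [set e in sdedge T | gtail e \notin svtx S]%SET.
pose o (e : dedge G) := [set e; ginv e]%SET.
have D_ge : (2 * #|svtx T :\: svtx S| <= #|D|)%N.
  have -> : #|D| = (\sum_(v in svtx T :\: svtx S)
      #|[set e in sdedge T | gtail e == v]%SET|)%N.
    rewrite -sum1_card (partition_big (@gtail G)
      (mem (svtx T :\: svtx S)%SET)) /=; last first.
      by move=> e; rewrite !inE => /andP[/subgraph_tail -> ->].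
    apply: eq_bigr => v; rewrite !inE => /andP[vS _].
    rewrite -sum1_card; apply: eq_bigl => e; rewrite !inE.
    by case: eqP => [->|]; rewrite ?andbF ?vS ?andbT.
  rewrite mulnC -sum_nat_const; apply: leq_sum => v; rewrite inE => /andP[_].
  exact: prT.
have D_le : (#|D| <= 2 * #|[set o e | e in D]%SET|)%N.
  apply: (@leq_trans #|finset.cover [set o e | e in D]%SET|).
    apply: subset_leq_card; apply/fintype.subsetP => e eD; apply/finset.bigcupP.
    by exists (o e); [exact: imset_f|rewrite !inE eqxx].
  apply: leq_trans (leq_card_cover _) _; rewrite mulnC -sum_nat_const.
  apply: leq_sum => _ /imsetP[e _ ->]; rewrite cards2; by case: (_ != _).
have eE : (#|subgraph_edges S| + #|[set o e | e in D]%SET|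
           <= #|subgraph_edges T|)%N.
  (* A subgraph is closed under the involution, so an orbit of [S] containing [e] would put [e], and
     hence its tail, in [S]. *)
  have dis : (subgraph_edges S :&: [set o e | e in D] = finset.set0)%SET.
    apply/setP => x; rewrite !inE; apply/negP => /andP[/imsetP[e' e'S ->]].
    move=> /imsetP[e]; rewrite inE => /andP[_ /negP eS] oe; apply: eS.
    apply: subgraph_tail; have : e \in o e by rewrite !inE eqxx.
    by rewrite -oe !inE => /orP[] /eqP -> //; apply: subgraph_inv.
  rewrite -cardsUI dis cards0 addn0; apply: subset_leq_card.
  apply/fintype.subsetP => x /setUP[] /imsetP[e eS ->];
    apply/imsetP; exists e => //.
    exact: (fintype.subsetP sE).
  by move: eS; rewrite inE => /andP[].
have vE : #|svtx T| = (#|svtx T :\: svtx S| + #|svtx S|)%N.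
  by rewrite [RHS]addnC -(cardsID (svtx S) (svtx T)) (finset.setIidPr sV).
rewrite /ord_sub vE; lia.
Qed.

(** Adding [T] can only add vertices, which does not raise the order, and every new edge is the
    orbit of a directed edge of [T]. *)
Lemma ord_sub_union1 P T :
  ord_sub (subgraph_union (T |: P)%SET) <=
  ord_sub (subgraph_union P) + #|sdedge T|%:Z.
Proof.
have vle : (#|svtx (subgraph_union P)|
            <= #|svtx (subgraph_union (T |: P)%SET)|)%N.
  apply/subset_leq_card.
  by case/andP: (subgraph_union_mono (finset.subsetUr [set T]%SET P)).
have ele : (#|subgraph_edges (subgraph_union (T |: P)%SET)|
            <= #|subgraph_edges (subgraph_union P)| + #|sdedge T|)%N.
  pose E := [set [set e; ginv e]%SET | e in sdedge T]%SET.
  have Ele : (#|E| <= #|sdedge T|)%N by exact: leq_imset_card.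
  apply: leq_trans (leq_add (leqnn _) Ele).
  apply: leq_trans (leq_card_setU _ _); apply: subset_leq_card.
  apply/fintype.subsetP => x /imsetP[e /finset.bigcupP[S]].
  rewrite !inE => /orP[/eqP ->|SP] eS ->; apply/orP; [right|left]; apply/imsetP;
    exists e => //.
  by apply/finset.bigcupP; exists S.
rewrite /ord_sub; lia.
Qed.
End SubgraphOrder.

(** * Embeddings of [B]-graphs and the transport of subgraphs along them *)

(** Inclusions of subgraphs and isomorphisms are both of this kind, so one invariance proof along
    embeddings serves both. *)
Record bemb (B : graph) (G H : bgraph B) := BEmb {
  embV : vtx G -> vtx H;
  embE : dedge G -> dedge H;
  embV_inj : injective embV;
  embE_inj : injective embE;
  emb_morph : is_morphism embV embE;
  emb_mapV : forall v, mapV (embV v) = mapV v;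
  emb_mapE : forall e, mapE (embE e) = mapE e }.

Section Embedding.
Variables (B : graph) (G H : bgraph B) (f : bemb G H).
Implicit Types S : subgraph G.

Lemma emb_sub_subproof S :
  subgraph_axiom (embV f @: svtx S, embE f @: sdedge S)%SET.
Proof.
have [hh ht hi] := emb_morph f.
apply/'forall_implyP => _ /imsetP[e eS ->] /=.
by rewrite hh ht hi !imset_f ?subgraph_head ?subgraph_tail ?subgraph_inv.
Qed.

Definition emb_sub S : subgraph H := Subgraph (emb_sub_subproof S).

Lemma emb_sub_inj : injective emb_sub.
Proof.
move=> S T [eV eE]; apply: subgraph_eq.
- exact: imset_inj (@embV_inj _ _ _ f) _ _ eV.
- exact: imset_inj (@embE_inj _ _ _ f) _ _ eE.
Qed.

Lemma emb_sub_union (P : {set subgraph G}) :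
  emb_sub (subgraph_union P) = subgraph_union (emb_sub @: P)%SET.
Proof.
(* Stated for an arbitrary set-valued [A] in order to treat vertices and directed edges at once. *)
have im (T U : finType) (g : T -> U) (A : subgraph G -> {set T})
    (A' : subgraph H -> {set U}) :
    (forall S, A' (emb_sub S) = g @: A S)%SET ->
    (g @: (\bigcup_(S in P) A S) = \bigcup_(S in emb_sub @: P) A' S)%SET.
  move=> AA'; apply/setP => x; apply/imsetP/finset.bigcupP.
  - move=> [y /finset.bigcupP[S SP yS] ->]; exists (emb_sub S).
      exact: imset_f.
    by rewrite AA' imset_f.
  - move=> [_ /imsetP[S SP ->]]; rewrite AA' => /imsetP[y yS ->].
    by exists y => //; apply/finset.bigcupP; exists S.
by apply: subgraph_eq; rewrite /svtx /sdedge /=; apply: im.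
Qed.

(** The preimage of [T] is a subgraph because [f] is a morphism, and its image is all of [T] because
    [T] lies in the image of [f]. *)
Lemma emb_sub_onto (T : subgraph H) :
  subgraph_le T (emb_sub (subgraph_full G)) -> exists S, emb_sub S = T.
Proof.
move=> /andP[TV TE]; have [hh ht hi] := emb_morph f.
have ax : subgraph_axiom (embV f @^-1: svtx T, embE f @^-1: sdedge T)%SET.
  apply/'forall_implyP => e /=; rewrite !inE => eT.
  by rewrite -hh -ht -hi subgraph_head ?subgraph_tail ?subgraph_inv.
exists (Subgraph ax); apply: subgraph_eq; apply/setP => x; apply/imsetP/idP.
- by move=> [y]; rewrite inE => + ->.
- move=> xT; have /imsetP[y _ xy] := fintype.subsetP TV _ xT.
  by exists y => //; rewrite inE -xy.
- by move=> [y]; rewrite inE => + ->.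
- move=> xT; have /imsetP[y _ xy] := fintype.subsetP TE _ xT.
  by exists y => //; rewrite inE -xy.
Qed.

Lemma emb_sub_bisom S : bisom (sub_bgraph S) (sub_bgraph (emb_sub S)).
Proof.
have [hh ht hi] := emb_morph f.
pose SV := {v : vtx G | v \in svtx S}.
pose SE := {e : dedge G | e \in sdedge S}.
pose SV' := {v : vtx H | v \in svtx (emb_sub S)}.
pose SE' := {e : dedge H | e \in sdedge (emb_sub S)}.
pose fV (v : SV) : SV' := Sub (embV f (val v)) (imset_f (embV f) (valP v)).
pose fE (e : SE) : SE' := Sub (embE f (val e)) (imset_f (embE f) (valP e)).
exists fV, fE; split.
- apply: (@inj_card_bij SV SV').
    by move=> u v /(congr1 val) /embV_inj /val_inj.
  by rewrite !card_sig (card_imset _ (@embV_inj _ _ _ f)).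
- apply: (@inj_card_bij SE SE').
    by move=> u v /(congr1 val) /embE_inj /val_inj.
  by rewrite !card_sig (card_imset _ (@embE_inj _ _ _ f)).
- by split=> e; apply: val_inj; rewrite /= (hh, ht, hi).
- by move=> v; rewrite /= emb_mapV.
- by move=> e; rewrite /= emb_mapE.
Qed.

Lemma card_edges_emb :
  #|edges G| = #|subgraph_edges (emb_sub (subgraph_full G))|.
Proof.
have [hh ht hi] := emb_morph f.
rewrite -(card_imset _ (imset_inj (@embE_inj _ _ _ f))); congr #|pred_of_set _|.
have fo e : (embE f @: [set e; ginv e] = [set embE f e; ginv (embE f e)])%SET.
  by rewrite imsetU !imset_set1 hi.
apply/setP => x; apply/imsetP/imsetP.
- by move=> [_ /imsetP[e _ ->] ->]; exists (embE f e); rewrite ?fo ?imset_f.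
- move=> [_ /imsetP[e _ ->] ->].
  by exists [set e; ginv e]%SET; [apply/imsetP; exists e|rewrite fo].
Qed.

Lemma ord_emb : ord G = ord_sub (emb_sub (subgraph_full G)).
Proof.
by rewrite /ord /ord_sub card_edges_emb (card_imset _ (@embV_inj _ _ _ f)).
Qed.

Lemma pruned_emb : pruned G -> pruned_sub (emb_sub (subgraph_full G)).
Proof.
have [hh ht hi] := emb_morph f.
move=> prG x /imsetP[v _ ->]; apply: leq_trans (prG v) _.
rewrite /degree -(card_imset _ (@embE_inj _ _ _ f)); apply: subset_leq_card.
apply/fintype.subsetP => y /imsetP[e]; rewrite inE => /eqP <- ->.
by rewrite inE ht eqxx andbT; apply: imset_f; rewrite inE.
Qed.

End Embedding.

(** * Inclusions and isomorphisms as embeddings *)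

Section Inclusion.
Variables (B : graph) (G : bgraph B) (S : subgraph G).

Lemma incl_subproof :
  @is_morphism (sub_graph S) G (fun v => val v) (fun e => val e).
Proof. by []. Qed.

Definition incl : bemb (sub_bgraph S) G :=
  @BEmb B (sub_bgraph S) G _ _ val_inj val_inj incl_subproof
    (fun=> erefl) (fun=> erefl).

Lemma incl_full : emb_sub incl (subgraph_full _) = S.
Proof.
apply: subgraph_eq; apply/setP => x; apply/imsetP/idP.
- by move=> [y _ ->]; exact: valP.
- by move=> xS; exists (Sub x xS); rewrite ?inE.
- by move=> [y _ ->]; exact: valP.
- by move=> xS; exists (Sub x xS); rewrite ?inE.
Qed.

Lemma ord_sub_bgraph : ord (sub_bgraph S) = ord_sub S.
Proof. by rewrite (ord_emb incl) incl_full. Qed.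

End Inclusion.

Lemma bisom_emb (B : graph) (G H : bgraph B) : bisom G H ->
  exists f : bemb G H, emb_sub f (subgraph_full G) = subgraph_full H.
Proof.
move=> [fV [fE [bV bE mor mV mE]]].
exists (BEmb (bij_inj bV) (bij_inj bE) mor mV mE); apply: subgraph_eq.
- by apply/setP => x; rewrite !inE; apply/imsetP; have [g _ gK] := bV;
    exists (g x); rewrite ?inE.
- by apply/setP => x; rewrite !inE; apply/imsetP; have [g _ gK] := bE;
    exists (g x); rewrite ?inE.
Qed.

Lemma bisom_sub_emb (B : graph) (G H : bgraph B) (S : subgraph H) :
  bisom G (sub_bgraph S) ->
  exists f : bemb G H, emb_sub f (subgraph_full G) = S.
Proof.
move=> [fV [fE [bV bE [hh ht hi] mV mE]]].
have mor : is_morphism (fun v => val (fV v)) (fun e => val (fE e)).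
  by split=> e; rewrite -?hh -?ht -?hi.
exists (@BEmb B G H _ _ (inj_comp val_inj (bij_inj bV))
  (inj_comp val_inj (bij_inj bE)) mor mV mE); apply: subgraph_eq.
- apply/setP => x; apply/imsetP/idP; first by move=> [y _ ->]; exact: valP.
  move=> xS; have [g _ gK] := bV; exists (g (Sub x xS)); rewrite ?inE //.
  by rewrite /= gK.
- apply/setP => x; apply/imsetP/idP; first by move=> [y _ ->]; exact: valP.
  move=> xS; have [g _ gK] := bE; exists (g (Sub x xS)); rewrite ?inE //.
  by rewrite /= gK.
Qed.

Lemma emb_family (B : graph) (G H : bgraph B) (f : bemb G H)
    (Q : {set subgraph H}) :
  (forall T, T \in Q -> subgraph_le T (emb_sub f (subgraph_full G))) ->
  exists P : {set subgraph G}, (Q = emb_sub f @: P)%SET.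
Proof.
move=> leQ; exists (emb_sub f @^-1: Q)%SET; apply/setP => T.
apply/idP/imsetP => [TQ|[S]]; last by rewrite inE => + ->.
by have [S ST] := emb_sub_onto (leQ _ TQ); exists S; rewrite // inE ST.
Qed.

(** * From sums over isomorphism classes to sums over subgraphs *)

(** As the members of [A] are full isomorphism classes, [count_in c G] counts the subgraphs whose
    class equals [c]. Exchanging the two sums leaves, for each subgraph, the single term of its own
    class. *)
Lemma sum_count_in (B : graph) (V : pzRingType) (A : set (set (bgraph B)))
    (g : set (bgraph B) -> V) (G : bgraph B) :
  finite_set A -> (forall c, A c -> exists p, c = isoclass p) ->
  \sum_(c \in A) (count_in c G)%:R * g c =
  \sum_(S : subgraph G | `[< A (isoclass (sub_bgraph S)) >])
    g (isoclass (sub_bgraph S)).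
Proof.
move=> finA clA; rewrite fsbig_finite //=.
transitivity (\sum_(c <- finmap.enum_fset (fset_set A))
    \sum_(S : subgraph G | isoclass (sub_bgraph S) == c) g c).
  apply: eq_big_seq => c; rewrite in_fset_set // inE => Ac.
  rewrite sumr_const mulr_natl; congr (_ *+ _); apply: eq_card => S.
  have [p cp] := clA _ Ac; rewrite inE unfold_in.
  apply/asboolP/asboolP => [|<-]; last exact: bisom_refl.
  by rewrite cp => pS; apply/isoclass_eqP; apply: bisom_sym.
rewrite big_seq (exchange_big_dep (fun S : subgraph G =>
  `[< A (isoclass (sub_bgraph S)) >])) /=; last first.
  by move=> c S; rewrite in_fset_set // inE => Ac /eqP ->; apply/asboolP.
apply: eq_bigr => S /asboolP AS; rewrite -big_seq_cond.
under eq_bigl do rewrite eq_sym.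
rewrite (finmap.fbig_pred1_inj (k := id) (f := g)) //.
by rewrite in_fset_set // inE.
Qed.

(** Descends [h] to classes by evaluating it at a chosen representative; the default [0] is taken
    only at the empty set, which is not an isomorphism class. *)
Definition class_fun (B : graph) (V : nmodType) (h : bgraph B -> V)
    (c : set (bgraph B)) : V :=
  if pselect (exists G, c G) is left cG then h (projT1 (cid cG)) else 0.

Lemma class_fun_isoclass (B : graph) (V : nmodType) (h : bgraph B -> V) G :
  (forall G H, bisom G H -> h G = h H) -> class_fun h (isoclass G) = h G.
Proof.
move=> hiso; rewrite /class_fun; case: pselect => [cG|[]]; last first.
  by exists G; apply: bisom_refl.
exact/esym/hiso/(projT2 (cid cG)).
Qed.

(** * Pieces, their unions, and the inclusion-exclusion coefficient *)

Section Psi.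
Variables (B : graph) (Psi : set (set (bgraph B))).
Hypothesis PsiP : forall c, Psi c -> exists p, c = isoclass p.
Implicit Types G H : bgraph B.

Definition pieces G : {set subgraph G} :=
  [set S : subgraph G | `[< lies_in Psi (sub_bgraph S) >]]%SET.

(** A pruned graph may be empty, so a piece may be empty too. [Meets] asks for a nonempty one,
    whereas unions in [Psi_plus] admit every piece; hence the two families. *)
Definition atoms G : {set subgraph G} :=
  [set S in pieces G | svtx S != finset.set0]%SET.

Definition union_of_pieces G (S : subgraph G) : bool :=
  [exists P : {set subgraph G},
    [&& P != finset.set0, P \subset pieces G & subgraph_union P == S]].

Definition covers G (S : subgraph G) : {set {set subgraph G}} :=
  [set P : {set subgraph G} | [&& P \subset atoms G, P != finset.set0 &
    subgraph_union P == S]]%SET.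

(** For a nonempty union [S] of atoms this is, by the cross-cut theorem, minus the Möbius function
    from the empty subgraph to [S] in the lattice of unions of atoms. *)
Definition moebius G (S : subgraph G) : rat :=
  \sum_(P in covers S) (-1) ^+ #|P|.+1.

Lemma lies_in_bisom G H : bisom G H -> lies_in Psi G -> lies_in Psi H.
Proof.
move=> GH [c Pc cG]; exists c => //; have [p cp] := PsiP Pc.
by move: cG; rewrite cp => cG; apply: bisom_trans GH.
Qed.

Lemma pieces_emb G H (f : bemb G H) S :
  (emb_sub f S \in pieces H) = (S \in pieces G).
Proof.
rewrite !inE; apply/asboolP/asboolP; apply: lies_in_bisom.
  exact/bisom_sym/emb_sub_bisom.
exact: emb_sub_bisom.
Qed.

Lemma atoms_emb G H (f : bemb G H) S :
  (emb_sub f S \in atoms H) = (S \in atoms G).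
Proof.
by rewrite inE pieces_emb [RHS]inE -!cards_eq0
  (card_imset _ (@embV_inj _ _ _ f)).
Qed.

Lemma sub_pieces_emb G H (f : bemb G H) (P : {set subgraph G}) :
  ((emb_sub f @: P)%SET \subset pieces H) = (P \subset pieces G).
Proof.
apply/fintype.subsetP/fintype.subsetP => PG S.
  by move=> SP; rewrite -(pieces_emb f) PG ?imset_f.
by move=> /imsetP[S' SP ->]; rewrite pieces_emb PG.
Qed.

Lemma sub_atoms_emb G H (f : bemb G H) (P : {set subgraph G}) :
  ((emb_sub f @: P)%SET \subset atoms H) = (P \subset atoms G).
Proof.
apply/fintype.subsetP/fintype.subsetP => PG S.
  by move=> SP; rewrite -(atoms_emb f) PG ?imset_f.
by move=> /imsetP[S' SP ->]; rewrite atoms_emb PG.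
Qed.

Lemma family_le_emb G H (f : bemb G H) S (Q : {set subgraph H}) T :
  subgraph_union Q = emb_sub f S -> T \in Q ->
  subgraph_le T (emb_sub f (subgraph_full G)).
Proof.
move=> QS /subgraph_union_ub; rewrite QS => /subgraph_le_trans; apply.
by apply/andP; split; apply: imsetS; apply: finset.subsetT.
Qed.

Lemma union_of_pieces_emb G H (f : bemb G H) S :
  union_of_pieces (emb_sub f S) = union_of_pieces S.
Proof.
apply/existsP/existsP => -[P /and3P[P0 PG /eqP PS]]; last first.
  exists (emb_sub f @: P)%SET.
  by rewrite imset_eq0 P0 sub_pieces_emb PG -emb_sub_union PS eqxx.
have [Q PQ] := emb_family (fun T => family_le_emb PS (T := T)).
exists Q; move: P0 PG PS; rewrite PQ imset_eq0 sub_pieces_emb -emb_sub_union.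
by move=> -> -> /emb_sub_inj ->; rewrite eqxx.
Qed.

(** A family with union [emb_sub f S] consists of subgraphs inside the image of [f], so it is the
    image of a unique family in [G], with the same cardinality. The coefficient therefore does not
    depend on the ambient graph. *)
Lemma moebius_emb G H (f : bemb G H) S : moebius (emb_sub f S) = moebius S.
Proof.
have inj_im := imset_inj (@emb_sub_inj _ _ _ f).
have covE : covers (emb_sub f S) =
    [set (emb_sub f @: P)%SET | P : {set subgraph G} in covers S]%SET.
  apply/setP => Q; apply/idP/imsetP => [|[P]]; rewrite !inE; last first.
    move=> /and3P[PG P0 /eqP PS] ->.
    by rewrite sub_atoms_emb PG imset_eq0 P0 -emb_sub_union PS eqxx.
  move=> /and3P[QG Q0 /eqP QS].
  have [P PQ] := emb_family (fun T => family_le_emb QS (T := T)).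
  exists P => //; move: QG Q0 QS.
  rewrite PQ imset_eq0 sub_atoms_emb -emb_sub_union inE.
  by move=> -> -> /emb_sub_inj ->; rewrite eqxx.
rewrite /moebius covE big_imset /=; last by move=> P Q _ _; apply: inj_im.
by apply: eq_bigr => P _; rewrite card_imset //; apply: emb_sub_inj.
Qed.

Lemma moebius_sub G (S : subgraph G) :
  moebius (subgraph_full (sub_bgraph S)) = moebius S.
Proof. by rewrite -(moebius_emb (incl S)) incl_full. Qed.

Lemma moebius_bisom G H : bisom G H ->
  moebius (subgraph_full G) = moebius (subgraph_full H).
Proof. by move=> /bisom_emb[f <-]; rewrite moebius_emb. Qed.

Lemma is_Psi_unionE G :
  is_Psi_union Psi G <-> union_of_pieces (subgraph_full G).
Proof.
split=> [[P [P0 PG PS]]|/existsP[P /and3P[P0 PG /eqP PS]]].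
  apply/existsP; exists P; rewrite P0 PS eqxx andbT /=.
  by apply/fintype.subsetP => S SP; rewrite inE; apply/asboolP/PG.
exists P; split=> // S SP; apply/asboolP.
by have := fintype.subsetP PG _ SP; rewrite inE.
Qed.

Lemma is_Psi_union_sub G (S : subgraph G) :
  is_Psi_union Psi (sub_bgraph S) <-> union_of_pieces S.
Proof.
by rewrite -{2}(incl_full S) union_of_pieces_emb; apply: is_Psi_unionE.
Qed.

(** Membership supplies only some representative of the class; both conditions pass to [G] by
    invariance under isomorphism. *)
Lemma Psi_plus_ltE r G : Psi_plus_lt Psi r (isoclass G) <->
  is_Psi_union Psi G /\ ord G < r%:Z.
Proof.
split=> [[H [uH oH] /isoclass_eqP HG]|uG]; last by exists G.
have [f fHG] := bisom_emb HG; split.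
  by rewrite is_Psi_unionE -fHG union_of_pieces_emb -is_Psi_unionE.
have fG := incl_full (subgraph_full G).
move: oH; rewrite (ord_emb f) fHG.
suff -> : ord G = ord_sub (subgraph_full G) by [].
have [g gGG] := bisom_emb (bisom_refl G).
by rewrite (ord_emb g) gGG.
Qed.

Lemma Psi_plus_lt_sub r G (S : subgraph G) :
  `[< Psi_plus_lt Psi r (isoclass (sub_bgraph S)) >] =
  union_of_pieces S && (ord_sub S < r%:Z).
Proof.
rewrite -ord_sub_bgraph; apply/asboolP/andP => [/Psi_plus_ltE|].
  by rewrite is_Psi_union_sub.
by rewrite -is_Psi_union_sub => /Psi_plus_ltE.
Qed.

Definition mu_class : set (bgraph B) -> rat :=
  class_fun (fun G => moebius (subgraph_full G)).

Lemma mu_class_sub G (S : subgraph G) :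
  mu_class (isoclass (sub_bgraph S)) = moebius S.
Proof.
by rewrite /mu_class class_fun_isoclass ?moebius_sub //; apply: moebius_bisom.
Qed.

End Psi.

(** * Alternating sums over subsets, and bounds on finite sets *)

Lemma sum_sign_subsets (T : finType) (A : {set T}) :
  \sum_(P : {set T} | (P \subset A) && (P != finset.set0)) (-1) ^+ #|P|.+1 =
  (A != finset.set0)%:R :> rat.
Proof.
(* Expanding the product of [1 + F i] over all [i] gives the signed sum over the subsets of [A]; the
   product has a factor [0] as soon as [A] has an element. *)
pose F (i : T) : rat := if i \in A then -1 else 0.
have prodF (J : {set T}) : \prod_i (if i \in J then F i else 1) =
    if J \subset A then (-1) ^+ #|J| else 0.
  rewrite -big_mkcond /=; case: ifPn => [JA|/fintype.subsetPn[i iJ iA]].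
    rewrite -prodr_const; apply: eq_bigr => i iJ.
    by rewrite /F (fintype.subsetP JA).
  by rewrite (bigD1 i) //= /F (negbTE iA) mul0r.
have sumE : \sum_(P : {set T} | P \subset A) (-1) ^+ #|P| =
    (A == finset.set0)%:R :> rat.
  rewrite big_mkcond -(eq_bigr _ (fun J _ => prodF J)) -(bigA_distr 1 _ F).
  have [A0|/finset.set0Pn[i iA]] := eqVneq A finset.set0.
    by rewrite big1 // => i _; rewrite /F A0 finset.in_set0 /= add0r.
  by rewrite (bigD1 i) //= /F iA addNr mul0r.
under eq_bigr do rewrite exprS mulN1r.
rewrite sumrN; move: sumE.
rewrite (bigD1 (finset.set0 : {set T})) ?finset.sub0set //= cards0 expr0.
by move/eqP; rewrite addrC eq_sym -subr_eq => /eqP <-; rewrite opprB; case: eqP.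
Qed.

Lemma finite_set_bounded (T : choiceType) (R : realDomainType) (A : set T)
    (f : T -> R) :
  finite_set A -> exists2 M, 0 <= M & forall c, A c -> `|f c| <= M.
Proof.
move=> /finite_seqP[s ->]; exists (\sum_(c <- s) `|f c|); first exact: sumr_ge0.
elim: s => // a s IH c; rewrite /= inE big_cons => /orP[/eqP ->|/IH fs].
  by rewrite lerDl sumr_ge0.
by apply: le_trans fs _; rewrite lerDr.
Qed.

(** * Evaluation of the truncated sum below order [r] and its bound above *)

Section Bounds.
Variables (B : graph) (Psi : set (set (bgraph B))) (N : nat).
Hypothesis PsiP : forall c, Psi c ->
  exists p, [/\ c = isoclass p, pruned p & (#|{: dedge p}| <= N)%N].
Implicit Types G H : bgraph B.

Let PsiP' c : Psi c -> exists p, c = isoclass p.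
Proof. by move=> /PsiP[p [? _ _]]; exists p. Qed.

(** Every nonempty set of atoms has exactly one union, so the sum regroups [sum_sign_subsets]. *)
Lemma sum_moebius G :
  \sum_(S : subgraph G) moebius Psi S = (atoms Psi G != finset.set0)%:R.
Proof.
rewrite -sum_sign_subsets (partition_big (@subgraph_union G) xpredT) //=.
apply: eq_bigr => S _; apply: eq_bigl => P.
by rewrite inE andbA.
Qed.

Lemma MeetsE G : (\1_(Meets Psi) G : rat) = (atoms Psi G != finset.set0)%:R.
Proof.
rewrite indicE; congr (nat_of_bool _)%:R; apply/idP/finset.set0Pn.
  by rewrite inE => -[S S0 SP]; exists S; rewrite !inE S0 andbT; apply/asboolP.
by move=> [S]; rewrite !inE => /andP[/asboolP SP S0]; exists S.
Qed.

Lemma pieces_pruned G (S : subgraph G) : S \in pieces Psi G ->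
  pruned_sub S /\ (#|sdedge S| <= N)%N.
Proof.
rewrite inE => /asboolP[c /PsiP[p [-> prp pN]] /bisom_sub_emb[f <-]].
split; first exact: pruned_emb.
by apply: leq_trans pN; rewrite -cardsT; apply: leq_imset_card.
Qed.

Lemma union_of_pieces_le_cap G (S : subgraph G) : union_of_pieces Psi S ->
  subgraph_le S (Psi_plus_cap Psi G).
Proof.
by move=> /existsP[P /and3P[_ PG /eqP <-]]; apply: subgraph_union_mono.
Qed.

Lemma subpieces_pruned G (P : {set subgraph G}) : P \subset pieces Psi G ->
  pruned_sub (subgraph_union P).
Proof.
move=> PG; apply: pruned_sub_union => S SP.
exact: (pieces_pruned (fintype.subsetP PG _ SP)).1.
Qed.

Lemma moebius_neq0 G (S : subgraph G) :
  moebius Psi S != 0 -> union_of_pieces Psi S.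
Proof.
move=> muS; have /finset.set0Pn[P] : covers Psi S != finset.set0.
  by apply: contraNneq muS => cov; rewrite /moebius cov big_set0.
rewrite inE => /and3P[PG P0 PS]; apply/existsP; exists P.
rewrite P0 PS andbT /=.
apply: fintype.subset_trans PG _; apply/fintype.subsetP => T.
by rewrite inE => /andP[].
Qed.

Lemma I_mu_classE r G : finite_set (Psi_plus_lt Psi r) ->
  I_ Psi (mu_class Psi) r G =
  \sum_(S : subgraph G | union_of_pieces Psi S && (ord_sub S < r%:Z))
    moebius Psi S.
Proof.
move=> fin; rewrite /I_ sum_count_in //; last by move=> _ [p _ <-]; exists p.
under eq_bigl do rewrite Psi_plus_lt_sub //.
by apply: eq_bigr => S _; apply: mu_class_sub.
Qed.

(** Truncation loses nothing: a subgraph with nonzero coefficient is a union of pieces, hence lies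
    below the pruned subgraph [Psi_plus_cap], whose order is less than [r]. *)
Lemma I_mu_class_lt r G : finite_set (Psi_plus_lt Psi r) ->
  ord_Psi Psi G < r%:Z -> I_ Psi (mu_class Psi) r G = \1_(Meets Psi) G.
Proof.
move=> fin ordG; rewrite I_mu_classE // MeetsE -sum_moebius big_mkcond /=.
apply: eq_bigr => S _; case: ifPn => // /negP uS.
apply/esym/eqP/negPn/negP => /moebius_neq0 u; apply: uS; rewrite u /=.
apply: le_lt_trans ordG; rewrite /ord_Psi ord_sub_bgraph.
apply: ord_sub_mono (union_of_pieces_le_cap u) _; exact: subpieces_pruned.
Qed.

(* Add pieces to S one at a time until the order reaches r: the last piece
   raises the order by at most its number of edges. *)
Lemma union_of_pieces_extend r G (S : subgraph G) :
  r%:Z <= ord_Psi Psi G -> union_of_pieces Psi S -> ord_sub S < r%:Z ->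
  exists T : subgraph G, [/\ subgraph_le S T, union_of_pieces Psi T,
    r%:Z <= ord_sub T & ord_sub T < (r + N)%:Z].
Proof.
rewrite /ord_Psi ord_sub_bgraph.
move=> rG /existsP[P /and3P[P0 PG /eqP <-]] Pr.
pose good (Q : {set subgraph G}) := [&& P \subset Q, Q \subset pieces Psi G &
  r%:Z <= ord_sub (subgraph_union Q)].
have good0 : good (pieces Psi G) by rewrite /good PG subxx rG.
(* A family of least cardinality stands for the moment at which [r] is first reached: removing a
   piece [T] outside [P] keeps [P] inside, so by minimality the order falls below [r]. *)
have [Q /and3P[PQ QG rQ] Qmin] :=
  arg_minnP (fun Q : {set subgraph G} => #|Q|) good0.
have [T TQ TP] : exists2 T, T \in Q & T \notin P.
  apply/fintype.subsetPn/negP => QP; move: Pr; have -> : P = Q.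
    by apply/eqP; rewrite finset.eqEsubset PQ.
  by rewrite ltNge rQ.
have [_ TN] := pieces_pruned (fintype.subsetP QG _ TQ).
have Qlt : ord_sub (subgraph_union (Q :\ T)%SET) < r%:Z.
  rewrite ltNge; apply/negP => rQT; have := Qmin (Q :\ T)%SET.
  rewrite /good rQT finset.subsetD1 PQ TP.
  rewrite (fintype.subset_trans (subD1set Q T) QG).
  by rewrite (cardsD1 T Q) TQ ltnn => /(_ isT).
exists (subgraph_union Q); split=> //; first exact: subgraph_union_mono.
- apply/existsP; exists Q; rewrite QG eqxx !andbT.
  by apply/finset.set0Pn; exists T.
- have := ord_sub_union1 (Q :\ T)%SET T; rewrite finset.setD1K //; lia.
Qed.

Lemma card_subgraph_bisom G H : bisom G H ->
  #|{: subgraph G}| = #|{: subgraph H}|.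
Proof.
have le G' H' : bisom G' H' -> (#|{: subgraph G'}| <= #|{: subgraph H'}|)%N.
  by move=> /bisom_emb[f _]; apply: leq_card (@emb_sub_inj _ _ _ f).
by move=> GH; apply/eqP; rewrite eqn_leq !le //; apply: bisom_sym.
Qed.

Lemma card_subgraph_le G (T : subgraph G) :
  (#|[set S | subgraph_le S T]%SET| <= #|{: subgraph (sub_bgraph T)}|)%N.
Proof.
rewrite -(card_imset _ (@emb_sub_inj _ _ _ (incl T))); apply: subset_leq_card.
apply/fintype.subsetP => S; rewrite inE -{1}(incl_full T).
by move=> /emb_sub_onto[S' <-]; apply: imset_f.
Qed.

Definition small r G : {set subgraph G} :=
  [set S : subgraph G | union_of_pieces Psi S && (ord_sub S < r%:Z)]%SET.

(** Each small [S] lies below some [T] of order in [[r, r + N)], and the number of subgraphs of [T]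
    depends only on its class, of which there are finitely many. *)
Lemma card_small_le r : finite_set (Psi_plus_lt Psi (r + N)) ->
  exists K : nat, forall G, r%:Z <= ord_Psi Psi G ->
  (#|small r G| <= K * #|small (r + N) G :\: small r G|)%N.
Proof.
move=> /(finite_set_bounded
  (class_fun (fun G => #|{: subgraph G}|%:Z)))[M M0 bM].
(* [M] is a nonnegative integer bounding the number of subgraphs over all these classes. *)
exists `|M|%N => G rG; rewrite mulnC -sum_nat_const.
apply: (@leq_trans (\sum_(T in small (r + N) G :\: small r G)
    #|[set S | subgraph_le S T]%SET|)%N).
  apply: (@leq_trans #|(\bigcup_(T in small (r + N) G :\: small r G)
      [set S | subgraph_le S T])%SET|); last first.
    elim/big_rec2: _ => [|T X n _ le]; first by rewrite cards0.
    by apply: leq_trans (leq_card_setU _ _) _; rewrite leq_add2l.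
  apply/subset_leq_card/fintype.subsetP => S; rewrite inE => /andP[uS oS].
  have [T [ST uT rT oT]] := union_of_pieces_extend rG uS oS.
  apply/finset.bigcupP; exists T; rewrite ?inE // uT oT /=.
  by rewrite -leNgt rT.
apply: leq_sum => T; rewrite !inE => /andP[_ T_small].
apply: leq_trans (card_subgraph_le T) _.
have /bM : Psi_plus_lt Psi (r + N) (isoclass (sub_bgraph T)).
  by apply/asboolP; rewrite Psi_plus_lt_sub.
rewrite class_fun_isoclass; first lia.
by move=> ? ? /card_subgraph_bisom ->.
Qed.

Lemma sum_count_small r s G (V : pzRingType) :
  finite_set (Psi_plus_lt Psi (r + s)) ->
  \sum_(c \in Psi_plus_lt Psi (r + s) `\` Psi_plus_lt Psi r)
    ((count_in c G)%:R : V) = #|small (r + s) G :\: small r G|%:R.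
Proof.
move=> fin.
transitivity (\sum_(c \in Psi_plus_lt Psi (r + s) `\` Psi_plus_lt Psi r)
    ((count_in c G)%:R * 1 : V)).
  by apply: eq_fsbigr => c _; rewrite mulr1.
rewrite (sum_count_in (fun=> 1)); first last.
- by move=> _ [[p _ <-] _]; exists p.
- exact: finite_setD.
rewrite sumr_const; congr _%:R; apply: eq_card => S.
rewrite unfold_in !inE -!(Psi_plus_lt_sub PsiP').
by apply/asboolP/andP => -[a b]; split=> //;
  (exact/asboolP || exact/asboolPn).
Qed.

(** The sum has one term per element of [small r G], each bounded by the maximal size [M] of the
    coefficient on finitely many classes; [card_small_le] then trades the number of terms for the
    band above [r]. *)
Lemma I_mu_class_bound r : (forall s, finite_set (Psi_plus_lt Psi s)) ->
  exists2 C : rat, 0 <= C & forall G, r%:Z <= ord_Psi Psi G ->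
  `|I_ Psi (mu_class Psi) r G| <= C * #|small (r + N) G :\: small r G|%:R.
Proof.
move=> fin; have [M M0 bM] := finite_set_bounded (mu_class Psi) (fin r).
have [K bK] := card_small_le (fin (r + N)%N).
exists (M * K%:R) => [|G rG]; first by rewrite mulr_ge0.
rewrite I_mu_classE //; apply: le_trans (ler_norm_sum _ _ _) _.
apply: (@le_trans _ _ (M * #|small r G|%:R)).
  rewrite mulr_natr -sumr_const.
  rewrite [leRHS](eq_bigl (fun S =>
    union_of_pieces Psi S && (ord_sub S < r%:Z)));
    last by move=> S; rewrite inE.
  apply: ler_sum => S; rewrite -(Psi_plus_lt_sub PsiP') => /asboolP/bM.
  by rewrite mu_class_sub.
by rewrite -mulrA ler_wpM2l // -natrM ler_nat bK.
Qed.

End Bounds.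

Theorem theorem8p6 (R : realType) (B : graph) (m : nat) (psi : 'I_m -> bgraph B)
    (Psi : set (set (bgraph B))) :
  Psi = [set isoclass (psi i) | i in [set: 'I_m]] ->
  (forall s : nat, finite_set (Psi_plus_lt Psi s)) ->
  (forall i : 'I_m, pruned (psi i)) ->
  exists mu : set (bgraph B) -> rat,
  forall r : nat,
    (forall G : bgraph B,
       ord_Psi Psi G < r%:Z -> I_ Psi mu r G = \1_(Meets Psi) G) /\
    (exists (C : R) (s : nat),
       forall G : bgraph B, r%:Z <= ord_Psi Psi G ->
         `|ratr (I_ Psi mu r G)| <=
         C * \sum_(c \in Psi_plus_lt Psi (r + s) `\` Psi_plus_lt Psi r)
               ((count_in c G)%:R : R)).
Proof.
(* [N] bounds the growth in order caused by one piece; it becomes the shift [s], the same for every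
   [r]. *)
move=> PsiE fin prpsi; pose N := (\max_(i < m) #|{: dedge (psi i)}|)%N.
have PsiP c : Psi c ->
    exists p, [/\ c = isoclass p, pruned p & (#|{: dedge p}| <= N)%N].
  rewrite PsiE => -[i _ <-]; exists (psi i); split=> //.
  exact: (leq_bigmax_cond (F := fun i => #|{: dedge (psi i)}|)).
exists (mu_class Psi) => r; split=> [G|]; first exact: (I_mu_class_lt PsiP).
have [C C0 bC] := I_mu_class_bound PsiP r fin.
exists (ratr C), N => G /bC; rewrite (sum_count_small PsiP) //.
by rewrite -(ler_rat R) ratr_norm rmorphM /= ratr_nat.
Qed.
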